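(* Let $L>0$ and let $f:\mathbb{R}^n\to\mathbb{R}$ be an $L$-smooth, possibly non-convex function with $f_{\inf}=\inf_{x\in\mathbb{R}^n}f(x)>-\infty$. Let $m\ge 1$, $\gamma_i>0$ and $\beta_i\in[0,1)$ for $i=1,\dots,m$, and let $(x_k)_{k\ge 0}$ be the sequence generated by the Aggregated Heavy-Ball method (AggHB) with stepsizes $\gamma_1,\dots,\gamma_m$ and momentum parameters $\beta_1,\dots,\beta_m$, started at $x_0\in\mathbb{R}^n$. Set $$A=\frac1m\sum_{i=1}^m\frac{\beta_i\gamma_i}{1-\beta_i},\quad C=\sum_{i=1}^m\frac{\gamma_i}{(1-\beta_i)^2},\quad D=\max_{1\le i\le m}\frac{\gamma_i}{1-\beta_i},\quad E=\sum_{i=1}^m\frac{1}{1-\beta_i},$$ and assume that $$-\frac{A}{2}\left(1-\frac{CDEL^2}{m^2}-LA\right)<0.$$ Then for all integers $K\ge 1$ $$\min_{1\le k\le K}\|\nabla f(x_k)\|_2^2\le \frac{2}{K}\cdot\frac{f(x_0)-f_{\inf}}{A\left(1-\frac{CDEL^2}{m^2}-LA\right)}.$$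
   Context: A differentiable function $f:\mathbb{R}^n\to\mathbb{R}$ is $L$-smooth if $\|\nabla f(x)-\nabla f(y)\|_2\le L\|x-y\|_2$ for all $x,y\in\mathbb{R}^n$. Aggregated Heavy-Ball method (AggHB): given $x_0\in\mathbb{R}^n$, stepsizes $\gamma_i>0$ and momentum parameters $\beta_i$ ($i=1,\dots,m$), put $V_{-1}^{(i)}=0$ and, for $k=0,1,2,\dots$, $$V_k^{(i)}=\beta_iV_{k-1}^{(i)}+\nabla f(x_k)\quad(i=1,\dots,m),\qquad x_{k+1}=x_k-\frac1m\sum_{i=1}^m\gamma_iV_k^{(i)}.$$ Thus $V_k^{(i)}=\sum_{l=0}^k\beta_i^l\nabla f(x_{k-l})$. *)

(* Defs.v *)
From HB Require Import structures.
From mathcomp Require Import all_boot all_order all_algebra.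
From mathcomp Require Import all_classical all_reals all_analysis.

Set Implicit Arguments.
Unset Strict Implicit.
Unset Printing Implicit Defensive.

Import Order.TTheory GRing.Theory Num.Theory.
Import numFieldNormedType.Exports.

Local Open Scope classical_set_scope.
Local Open Scope ring_scope.

(* The library norm `|v| on 'rV[R]_n is the sup norm, so the Euclidean norm is
   defined here. *)
Definition norm2 (R : realType) (n : nat) (v : 'rV[R]_n) : R :=
  Num.sqrt (\sum_(j < n) v ord0 j ^+ 2).

(* Meaningful only where f is differentiable: 'D_v f x is a default value when
   the limit does not exist. *)
Definition grad (R : realType) (n : nat) (f : 'rV[R]_n -> R) (x : 'rV[R]_n)
    : 'rV[R]_n :=
  \row_(j < n) 'D_(delta_mx ord0 j) f x.

Definition L_smooth (R : realType) (n : nat) (L : R) (f : 'rV[R]_n -> R)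
    : Prop :=
  (forall x, differentiable f x) /\
  (forall x y, norm2 (grad f x - grad f y) <= L * norm2 (x - y)).

Section AggHB.
Variables (R : realType) (n m : nat) (f : 'rV[R]_n -> R).
Variables (gamma beta : 'I_m -> R) (x0 : 'rV[R]_n).

Definition agghb_momentum (x : 'rV[R]_n) (V : 'I_m -> 'rV[R]_n)
    : 'I_m -> 'rV[R]_n :=
  fun i => beta i *: V i + grad f x.

(* The state at time k is the pair (x_k, V_(k-1)). *)
Fixpoint agghb_state (k : nat) : 'rV[R]_n * ('I_m -> 'rV[R]_n) :=
  if k is k'.+1 then
    let: (x, V) := agghb_state k' in
    let V' := agghb_momentum x V in
    (x - m%:R^-1 *: \sum_(i < m) gamma i *: V' i, V')
  else (x0, fun=> 0).

Definition agghb (k : nat) : 'rV[R]_n := (agghb_state k).1.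

Definition agghb_A : R :=
  m%:R^-1 * \sum_(i < m) (beta i * gamma i / (1 - beta i)).

Definition agghb_C : R := \sum_(i < m) (gamma i / (1 - beta i) ^+ 2).

(* The base value 0 does not affect the maximum, since 0 < m and all the terms
   are positive for the admissible parameters. *)
Definition agghb_D : R := \big[Num.max/0]_(i < m) (gamma i / (1 - beta i)).

Definition agghb_E : R := \sum_(i < m) (1 - beta i)^-1.

End AggHB.

(* min_(1 <= k <= K) u k for 1 <= K; the base value u 1 is itself one of the
   terms. *)
Definition min_1_to (R : realType) (K : nat) (u : nat -> R) : R :=
  \big[Num.min/u 1%N]_(1 <= k < K.+1) u k.

(* Main.v *)
Require Import Defs.
From HB Require Import structures.
From mathcomp Require Import all_boot all_order all_algebra.
From mathcomp Require Import all_classical all_reals all_analysis.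
From mathcomp Require Import ring lra.

Import Order.TTheory GRing.Theory Num.Theory.
Import numFieldNormedType.Exports.

Local Open Scope classical_set_scope.
Local Open Scope ring_scope.

(** Write [g_k] for the gradient at [x_k], [S] for the mean of
    [gamma_i / (1 - beta_i)], [a_i = beta_i gamma_i / (1 - beta_i)] and [P] for
    the mean of [a_i / (1 - beta_i)].  The shifted iterate
    [z_k = x_k - mean_i (a_i V_(k-1)^(i))] performs an inexact gradient step
    [z_(k+1) = z_k - S g_k], where [g_k] is evaluated at distance
    [|x_k - z_k|] from [z_k].  By the descent lemma, and by Jensen's inequality
    for the momenta, the Lyapunov function
    [f (z_k) + S L^2 P / 2 * mean_i (a_i |V_(k-1)^(i)|^2)] decreases by at least
    [S / 2 * (1 - L S - L^2 P^2) * |g_k|^2] in each step.  With [c = C / m] one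
    has [c = S + P], [c^2 <= C D E / m^2] and, by Jensen's inequality again,
    [A c <= S P]; together with [L c < 1] these give
    [A (1 - C D E L^2 / m^2 - L A) <= S (1 - L S - L^2 P^2)]. *)

(** * Jensen's inequality for unnormalised weights *)

Lemma jensen_sqr (R : realFieldType) (I : finType) (b y : I -> R) :
  (forall i, 0 <= b i) ->
  (\sum_i b i * y i) ^+ 2 <= (\sum_i b i) * \sum_i b i * y i ^+ 2.
Proof.
move=> b_ge0; set B := \sum_i b i; set T := \sum_i b i * y i.
set Q := \sum_i b i * y i ^+ 2.
have B_ge0 : 0 <= B by apply: sumr_ge0.
have [B0|B_neq0] := eqVneq B 0.
  have b0 i : b i = 0 by apply: (psumr_eq0P (fun j _ => b_ge0 j) B0).
  suff -> : T = 0 by rewrite B0 expr0n /= mul0r.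
  by rewrite /T big1 // => i _; rewrite b0 mul0r.
have B_gt0 : 0 < B by rewrite lt_def B_neq0.
(* A weighted variance: the deviations from the mean [T / B], scaled by [B]. *)
have : 0 <= \sum_i b i * (B * y i - T) ^+ 2.
  by apply: sumr_ge0 => i _; rewrite mulr_ge0 ?sqr_ge0.
suff -> : \sum_i b i * (B * y i - T) ^+ 2 = B * (B * Q - T ^+ 2).
  by rewrite pmulr_rge0 // subr_ge0.
rewrite (eq_bigr (fun i => B ^+ 2 * (b i * y i ^+ 2)
    - 2 * B * T * (b i * y i) + T ^+ 2 * b i)); last by move=> i _; ring.
by rewrite big_split sumrB -!mulr_sumr -/B -/T -/Q /=; ring.
Qed.

(** * Euclidean norm, gradient and descent lemma *)

Section Euclidean.
Variables (R : realType) (n : nat).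
Implicit Types u v : 'rV[R]_n.

Lemma sqr_norm2 v : norm2 v ^+ 2 = \sum_(j < n) v ord0 j ^+ 2.
Proof. by rewrite sqr_sqrtr // sumr_ge0 // => j _; rewrite sqr_ge0. Qed.

Lemma norm2_ge0 v : 0 <= norm2 v.
Proof. exact: sqrtr_ge0. Qed.

Lemma L_smooth_sqr (L : R) (f : 'rV[R]_n -> R) u v : L_smooth L f ->
  norm2 (grad f u - grad f v) ^+ 2 <= L ^+ 2 * norm2 (u - v) ^+ 2.
Proof.
move=> [_ /(_ u v) smooth_uv]; rewrite -exprMn ler_pXn2r ?nnegrE ?norm2_ge0 //.
exact: le_trans (norm2_ge0 _) smooth_uv.
Qed.

Lemma diff_grad (f : 'rV[R]_n -> R) u v : differentiable f u ->
  'd f u v = \sum_(j < n) grad f u ord0 j * v ord0 j.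
Proof.
move=> df; rewrite {1}(row_sum_delta v) linear_sum; apply: eq_bigr => j _.
by rewrite linearZ /= mxE deriveE // mulrC.
Qed.

(** The mean value theorem replaces the usual integral of the gradient along the segment. *)
Lemma descent_lemma (L : R) (f : 'rV[R]_n -> R) u v : 0 < L -> L_smooth L f ->
  f (u + v) <= f u + \sum_(j < n) grad f u ord0 j * v ord0 j
               + L / 2 * norm2 v ^+ 2.
Proof.
move=> L_gt0 Lf; have [df _] := Lf.
pose p := \sum_(j < n) grad f u ord0 j * v ord0 j; pose q := norm2 v ^+ 2.
(* Up to the constant [f u], this is [f] on the segment minus its quadratic majorant; the claim is
   [phi 1 <= phi 0]. *)
pose phi t := f (u + t *: v) - t * p - L / 2 * t ^+ 2 * q.
pose dphi t := 'd f (u + t *: v) v - p - L * t * q.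
have phi' t : is_derive t (1 : R) phi (dphi t).
  have df1 : is_derive t (1 : R) (fun t => f (u + t *: v)) ('d f (u + t *: v) v).
    have dg : is_diff t (fun t : R => u + t *: v) (fun t : R => t *: v).
      have := is_diffD (is_diff_cst u t) (is_diff_scalel t v).
      by rewrite add0r.
    have dc := is_diff_comp dg (differentiableP (df (u + t *: v))).
    apply: DeriveDef; first by apply/derivable1_diffP; apply: ex_diff.
    rewrite deriveE; last exact: ex_diff.
    by rewrite diff_val /= scale1r.
  rewrite /phi /dphi; apply: is_derive_eq.
  by rewrite /GRing.scale /=; field.
have cphi : {within `[0, 1], continuous phi}.
  apply: derivable_within_continuous => t _.
  by have [] := phi' t.
have [t] := MVT ltr01 (fun t _ => phi' t) cphi.
rewrite in_itv /= subr0 mulr1 => /andP[t_gt0 t_lt1] phi10.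
suff dphi_le0 : dphi t <= 0.
  move: dphi_le0; rewrite -phi10 /phi scale1r scale0r addr0 -/p -/q => H.
  lra.
have Lt_gt0 : 0 < L * t by rewrite mulr_gt0.
have smooth := L_smooth_sqr _ _ (u + t *: v) u Lf.
(* With this factor, [2 a b <= a^2 + b^2] in each coordinate stands in for Cauchy-Schwarz; both
   resulting squares are at most [(L * t) ^+ 2 * q]. *)
rewrite -(ler_pM2l (_ : 0 < 2 * (L * t))) ?mulr_gt0 // mulr0.
rewrite /dphi diff_grad // /p -sumrB.
under eq_bigr do rewrite -mulrBl.
rewrite mulrBr subr_le0.
apply: (@le_trans _ _ (norm2 (grad f (u + t *: v) - grad f u) ^+ 2
                        + (L * t) ^+ 2 * q)).
  rewrite /q !sqr_norm2 !mulr_sumr -big_split; apply: ler_sum => j _ /=.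
  rewrite [X in _ <= X ^+ 2 + _]mxE [X in _ <= (_ + X) ^+ 2 + _]mxE.
  set a := grad f (u + t *: v) ord0 j; set b := grad f u ord0 j.
  set w := v ord0 j.
  have := sqr_ge0 (a - b - L * t * w); lra.
have : norm2 (u + t *: v - u) ^+ 2 = t ^+ 2 * q.
  rewrite addrC addKr /q !sqr_norm2 mulr_sumr.
  by apply: eq_bigr => j _; rewrite mxE exprMn.
move=> E; rewrite E in smooth; lra.
Qed.

End Euclidean.

(** * Shifted iterates and the Lyapunov function *)

Section AggHB.
Variables (R : realType) (n m : nat) (L : R) (f : 'rV[R]_n -> R).
Variables (gamma beta : 'I_m -> R) (x0 : 'rV[R]_n).
Hypotheses (L_gt0 : 0 < L) (f_smooth : L_smooth L f).
Hypotheses (f_bounded_below : has_lbound (range f)) (m_gt0 : (0 < m)%N).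
Hypotheses (gamma_gt0 : forall i, 0 < gamma i).
Hypothesis beta_range : forall i, 0 <= beta i < 1.

Let state := ('rV[R]_n * ('I_m -> 'rV[R]_n))%type.
(* As in agghb_state, the state (x_k, V_(k-1)) carries the momenta of the
   previous step. *)
Implicit Types s : state.

Definition drift_weight i := beta i * gamma i / (1 - beta i).
Definition effective_step := m%:R^-1 * \sum_(i < m) gamma i / (1 - beta i).
Definition drift_gain := m%:R^-1 * \sum_(i < m) drift_weight i / (1 - beta i).
Definition drift s := m%:R^-1 *: \sum_(i < m) drift_weight i *: s.2 i.

Definition agghb_step s : state :=
  let V := agghb_momentum f beta s.1 s.2 in
  (s.1 - m%:R^-1 *: \sum_(i < m) gamma i *: V i, V).

(** The coefficient is chosen so that the decay of the momentum energy absorbs the error of taking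
    the gradient at [s.1] instead of [s.1 - drift s]. *)
Definition lyapunov s := f (s.1 - drift s)
  + effective_step * L ^+ 2 * drift_gain / 2
    * (m%:R^-1 * \sum_(i < m) drift_weight i * norm2 (s.2 i) ^+ 2).

Let onemB_gt0 i : 0 < 1 - beta i.
Proof. by rewrite subr_gt0; have /andP[] := beta_range i. Qed.

Let beta_ge0 i : 0 <= beta i. Proof. by have /andP[] := beta_range i. Qed.

Let invm_gt0 : 0 < m%:R^-1 :> R. Proof. by rewrite invr_gt0 ltr0n. Qed.

Lemma drift_weight_ge0 i : 0 <= drift_weight i.
Proof. by rewrite divr_ge0 ?mulr_ge0 // ltW. Qed.

Lemma effective_step_ge0 : 0 <= effective_step.
Proof.
by rewrite mulr_ge0 ?(ltW invm_gt0) ?sumr_ge0 // => i _; rewrite divr_ge0 ?ltW.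
Qed.

Lemma drift_gain_ge0 : 0 <= drift_gain.
Proof.
rewrite mulr_ge0 ?(ltW invm_gt0) ?sumr_ge0 // => i _.
by rewrite divr_ge0 ?drift_weight_ge0 ?ltW.
Qed.

Lemma agghb_stateS k :
  agghb_state f gamma beta x0 k.+1 = agghb_step (agghb_state f gamma beta x0 k).
Proof. by rewrite /=; case: agghb_state. Qed.

(** Since [gamma_i + a_i = gamma_i / (1 - beta_i)] and [beta_i] times this is [a_i], the old momenta
    keep their weights in the new shifted point. *)
Lemma agghb_step_undrifted s :
  (agghb_step s).1 - drift (agghb_step s)
  = (s.1 - drift s) + - effective_step *: grad f s.1.
Proof.
rewrite /drift /effective_step /=; apply/rowP => j.
rewrite !mxE !summxE -!addrA; congr (_ + _).
rewrite -!mulrN -mulrA -!mulrDr; congr (_ * _).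
rewrite mulNr mulr_suml -!sumrN -!big_split /=; apply: eq_bigr => i _.
by rewrite !mxE /drift_weight; field; rewrite gt_eqF.
Qed.

(** Jensen with weights [a_i / (1 - beta_i)] and values [(1 - beta_i) V_i]; this split leaves the
    factor [1 - beta_i] that also governs the decay of the momentum energy. *)
Lemma sqr_norm2_drift s :
  norm2 (drift s) ^+ 2 <=
    drift_gain * (m%:R^-1 * \sum_(i < m) drift_weight i * (1 - beta i)
                                        * norm2 (s.2 i) ^+ 2).
Proof.
rewrite sqr_norm2.
under [X in _ <= _ * (_ * X)]eq_bigr do rewrite sqr_norm2 mulr_sumr.
rewrite exchange_big /= !mulr_sumr; apply: ler_sum => j _.
rewrite mxE summxE exprMn /drift_gain.
have b_ge0 i : 0 <= drift_weight i / (1 - beta i).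
  by rewrite divr_ge0 ?drift_weight_ge0 ?ltW.
have /(ler_wpM2l (sqr_ge0 m%:R^-1)) :=
  jensen_sqr R _ _ (fun i => (1 - beta i) * s.2 i ord0 j) b_ge0.
rewrite (eq_bigr (fun i => (drift_weight i *: s.2 i) ord0 j)); last first.
  by move=> i _; rewrite mxE mulrA divfK ?gt_eqF.
move=> /le_trans; apply; rewrite le_eqVlt; apply/orP; left; apply/eqP.
rewrite [in RHS]mulrACA -expr2; congr (_ * (_ * _)).
by apply: eq_bigr => i _; field; rewrite gt_eqF.
Qed.

(** Convexity of the square, applied to [beta v + (1 - beta) (g / (1 - beta))]. *)
Lemma sqr_norm2_momentum s i :
  norm2 (agghb_momentum f beta s.1 s.2 i) ^+ 2 <=
    beta i * norm2 (s.2 i) ^+ 2 + norm2 (grad f s.1) ^+ 2 / (1 - beta i).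
Proof.
rewrite !sqr_norm2 mulr_sumr mulr_suml -big_split; apply: ler_sum => j _ /=.
rewrite [X in X ^+ 2 <= _]mxE [X in (X + _) ^+ 2 <= _]mxE.
set v := s.2 i ord0 j; set g := grad f s.1 ord0 j.
rewrite -subr_ge0.
have -> : beta i * v ^+ 2 + g ^+ 2 / (1 - beta i) - (beta i * v + g) ^+ 2
        = beta i / (1 - beta i) * ((1 - beta i) * v - g) ^+ 2.
  by field; rewrite gt_eqF.
by rewrite mulr_ge0 ?sqr_ge0 // divr_ge0 // ltW.
Qed.

Lemma lyapunov_step s :
  lyapunov (agghb_step s) <= lyapunov s -
    effective_step / 2 * (1 - L * effective_step - L ^+ 2 * drift_gain ^+ 2)
    * norm2 (grad f s.1) ^+ 2.
Proof.
rewrite /lyapunov agghb_step_undrifted.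
set z := s.1 - drift s; set S := effective_step; set P := drift_gain.
have S_ge0 : 0 <= S := effective_step_ge0.
have P_ge0 : 0 <= P := drift_gain_ge0.
set G := norm2 (grad f s.1) ^+ 2.
have f_le : f (z + - S *: grad f s.1)
    <= f z - S / 2 * (1 - L * S) * G + S * L ^+ 2 / 2 * norm2 (drift s) ^+ 2.
  apply: le_trans (descent_lemma _ _ _ _ _ _ L_gt0 f_smooth) _.
  have := L_smooth_sqr _ _ _ _ z s.1 f_smooth.
  have -> : norm2 (z - s.1) ^+ 2 = norm2 (drift s) ^+ 2.
    rewrite !sqr_norm2; apply: eq_bigr => j _.
    by rewrite /z addrAC subrr add0r mxE sqrrN.
  move=> smooth.
  have /(ler_wpM2l S_ge0) smooth' := smooth.
  have -> : norm2 (- S *: grad f s.1) ^+ 2 = S ^+ 2 * G.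
    rewrite /G !sqr_norm2 mulr_sumr; apply: eq_bigr => j _.
    by rewrite mxE exprMn sqrrN.
  (* Polarisation, with the term [- S / 2 * |grad f z|^2] dropped. *)
  have : \sum_(j < n) grad f z ord0 j * (- S *: grad f s.1) ord0 j
      <= S / 2 * norm2 (grad f z - grad f s.1) ^+ 2 - S / 2 * G.
    rewrite /G !sqr_norm2 !mulr_sumr -sumrB; apply: ler_sum => j _.
    rewrite [X in _ * X <= _]mxE [X in _ <= _ * X ^+ 2 - _]mxE.
    rewrite [X in _ <= _ * (_ + X) ^+ 2 - _]mxE.
    set p := grad f z ord0 j; set g := grad f s.1 ord0 j.
    have -> : S / 2 * (p - g) ^+ 2 - S / 2 * g ^+ 2
            = p * (- S * g) + S * p ^+ 2 / 2 by field.
    by rewrite lerDl divr_ge0 // mulr_ge0 ?sqr_ge0.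
  lra.
have drift_le := sqr_norm2_drift s.
have V_le : m%:R^-1 * \sum_(i < m) drift_weight i
      * norm2 (agghb_momentum f beta s.1 s.2 i) ^+ 2
    <= m%:R^-1 * (\sum_(i < m) drift_weight i * norm2 (s.2 i) ^+ 2)
       - m%:R^-1 * (\sum_(i < m) drift_weight i * (1 - beta i)
                                * norm2 (s.2 i) ^+ 2)
       + P * G.
  rewrite /P /drift_gain -[_ * _ * G]mulrA -mulrBr -mulrDr ler_pM2l //.
  rewrite mulr_suml -sumrB -big_split; apply: ler_sum => i _ /=.
  have := ler_wpM2l (drift_weight_ge0 i) (sqr_norm2_momentum s i).
  rewrite -/G; lra.
(* Scaling [drift_le] by this constant and [V_le] by [P] times it cancels the sums weighted by
   [1 - beta i]; the term [P * G] becomes the [L^2 P^2] loss. *)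
have c_ge0 : 0 <= S * L ^+ 2 / 2 by rewrite divr_ge0 // mulr_ge0 ?sqr_ge0.
have /(ler_wpM2l (mulr_ge0 c_ge0 P_ge0)) := V_le.
have /(ler_wpM2l c_ge0) := drift_le.
rewrite -/P /=; move: f_le.
lra.
Qed.

(** Telescoping: the Lyapunov function starts at [f x0], as the initial momenta vanish, and stays
    above the infimum of [f]. *)
Lemma sum_sqr_grad_le (K : nat) :
  effective_step / 2 * (1 - L * effective_step - L ^+ 2 * drift_gain ^+ 2)
    * \sum_(0 <= k < K) norm2 (grad f (agghb f gamma beta x0 k)) ^+ 2
  <= f x0 - inf (range f).
Proof.
set c := _ / 2 * _; pose sk := agghb_state f gamma beta x0.
have lyap0 : lyapunov (sk 0) = f x0.
  rewrite /lyapunov /drift /= big1 => [|i _]; last by rewrite scaler0.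
  rewrite big1 => [|i _]; last first.
    rewrite sqr_norm2 big1 ?mulr0 // => j _.
    by rewrite mxE expr0n.
  by rewrite scaler0 subr0 !mulr0 addr0.
have lyap_ge s : inf (range f) <= lyapunov s.
  apply: (@le_trans _ _ (f (s.1 - drift s))).
    by apply: ge_inf => //; exists (s.1 - drift s).
  rewrite /lyapunov lerDl mulr_ge0 //.
    rewrite divr_ge0 // mulr_ge0 ?drift_gain_ge0 //.
    by rewrite mulr_ge0 ?sqr_ge0 ?effective_step_ge0.
  rewrite mulr_ge0 ?(ltW invm_gt0) ?sumr_ge0 // => i _.
  by rewrite mulr_ge0 ?sqr_ge0 ?drift_weight_ge0.
suff : c * \sum_(0 <= k < K) norm2 (grad f (agghb f gamma beta x0 k)) ^+ 2
    <= f x0 - lyapunov (sk K).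
  by move/le_trans; apply; rewrite lerD2l lerN2.
elim: K => [|K IH]; first by rewrite big_geq // mulr0 lyap0 subrr.
rewrite big_nat_recr //= mulrDr.
have := lyapunov_step (sk K); rewrite -agghb_stateS -/c.
rewrite /sk /agghb in IH *; lra.
Qed.

(** * Comparison of the constants *)

Lemma sqr_C_le_CDE :
  agghb_C gamma beta ^+ 2 <= agghb_C gamma beta * agghb_D gamma beta
                             * agghb_E beta.
Proof.
rewrite expr2 -mulrA; apply: ler_wpM2l.
  by apply: sumr_ge0 => i _; rewrite divr_ge0 ?sqr_ge0 ?ltW.
(* [C <= D * E] holds termwise, by bounding one factor [gamma i / (1 - beta i)] by [D]. *)
rewrite mulr_sumr; apply: ler_sum => i _.
rewrite expr2 invfM mulrA ler_pM2r ?invr_gt0 //.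
exact: (le_bigmax _ (fun i => gamma i / (1 - beta i))).
Qed.

Lemma rate_le :
  let A := agghb_A gamma beta in
  let W := 1 - agghb_C gamma beta * agghb_D gamma beta * agghb_E beta
               * L ^+ 2 / m%:R ^+ 2 - L * A in
  0 < A * W ->
  A * W <= effective_step
           * (1 - L * effective_step - L ^+ 2 * drift_gain ^+ 2).
Proof.
move=> A W AW_gt0.
set S := effective_step; set P := drift_gain.
pose G := m%:R^-1 * \sum_(i < m) gamma i.
pose c := m%:R^-1 * agghb_C gamma beta.
have A_ge0 : 0 <= A.
  rewrite mulr_ge0 ?(ltW invm_gt0) // sumr_ge0 // => i _.
  exact: drift_weight_ge0.
have A_gt0 : 0 < A.
  rewrite lt_def A_ge0 andbT.
  by apply: contraTneq AW_gt0 => ->; rewrite mul0r ltxx.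
have W_gt0 : 0 < W by rewrite -(pmulr_rgt0 _ A_gt0).
have S_ge0 : 0 <= S := effective_step_ge0.
have P_ge0 : 0 <= P := drift_gain_ge0.
have cE : c = S + P.
  rewrite /c /S /P /effective_step /drift_gain -mulrDr -big_split /=.
  congr (_ * _); apply: eq_bigr => i _.
  by rewrite /drift_weight; field; rewrite gt_eqF.
have AE : A = S - G.
  rewrite /A /S /G /effective_step /agghb_A -mulrBr -sumrB.
  congr (_ * _); apply: eq_bigr => i _.
  by field; rewrite gt_eqF.
(* Jensen with weights [gamma i] and values [1 / (1 - beta i)]; given [A = S - G] and [c = S + P],
   this amounts to [A * c <= S * P]. *)
have SGc : S ^+ 2 <= G * c.
  have /(ler_wpM2l (sqr_ge0 m%:R^-1)) := jensen_sqr R _ gamma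
    (fun i => (1 - beta i)^-1) (fun i => ltW (gamma_gt0 i)).
  rewrite -exprMn -/effective_step -/S.
  move=> /le_trans; apply; rewrite le_eqVlt; apply/orP; left; apply/eqP.
  rewrite /G /c /agghb_C [in RHS]mulrACA -expr2; congr (_ * (_ * _)).
  by apply: eq_bigr => i _; rewrite exprVn.
have S_gt0 : 0 < S.
  have G_ge0 : 0 <= G.
    by rewrite mulr_ge0 ?(ltW invm_gt0) ?sumr_ge0 // => i _; apply: ltW.
  lra.
have c_gt0 : 0 < c by lra.
have AcSP : A * c <= S * P by rewrite AE; move: SGc; rewrite cE; lra.
have W_le : W <= 1 - L ^+ 2 * c ^+ 2 - L * A.
  have : c ^+ 2 <= agghb_C gamma beta * agghb_D gamma beta * agghb_E beta
                   / m%:R ^+ 2.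
    rewrite /c exprMn exprVn mulrC ler_pM2r ?invr_gt0 ?exprn_gt0 ?ltr0n //.
    exact: sqr_C_le_CDE.
  move=> /(ler_wpM2l (sqr_ge0 L)); rewrite /W; lra.
(* From [0 < W <= 1 - (L c)^2 - L A] and [0 < L A]. *)
have Lc_lt1 : L * c < 1.
  have : (L * c) ^+ 2 < 1.
    rewrite exprMn; have := mulr_gt0 L_gt0 A_gt0; lra.
  by rewrite expr_lt1 // mulr_ge0 // ltW.
have ALc : A * W <= A * (1 - L ^+ 2 * c ^+ 2).
  rewrite ler_pM2l //; have := mulr_gt0 L_gt0 A_gt0; lra.
apply: le_trans ALc _.
rewrite -(ler_pM2r c_gt0).
have Lc_sqr : 0 <= 1 - L ^+ 2 * c ^+ 2.
  by rewrite -exprMn subr_ge0 expr_le1 ?(ltW Lc_lt1) // mulr_ge0 // ltW.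
have := ler_wpM2r Lc_sqr AcSP.
(* With [c = S + P], this is exactly [S (1 - L S - L^2 P^2) c - S P (1 - L^2 c^2)]. *)
have : 0 <= S ^+ 2 * (1 - L * c + L ^+ 2 * P * c).
  rewrite mulr_ge0 ?sqr_ge0 // addr_ge0 ?subr_ge0 ?(ltW Lc_lt1) //.
  by rewrite mulr_ge0 ?(ltW c_gt0) // mulr_ge0 ?sqr_ge0.
rewrite cE; lra.
Qed.

End AggHB.

(** * From the sum to the minimum *)

Lemma min_1_to_mulrn_le_sum (R : realType) (u : nat -> R) (K : nat) :
  min_1_to K u *+ K <= \sum_(1 <= k < K.+1) u k.
Proof.
rewrite -[leLHS](_ : \sum_(1 <= k < K.+1) min_1_to K u = _); last first.
  by rewrite sumr_const_nat subSS subn0.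
rewrite big_nat [leRHS]big_nat; apply: ler_sum => k k_in.
by apply: ge_bigmin_seq; rewrite ?mem_index_iota.
Qed.

Theorem theorem2p1 (R : realType) (n m : nat) (L : R) (f : 'rV[R]_n -> R)
    (gamma beta : 'I_m -> R) (x0 : 'rV[R]_n)
    (L_gt0 : 0 < L)
    (f_smooth : L_smooth L f)
    (f_bounded_below : has_lbound (range f))
    (m_ge1 : (1 <= m)%N)
    (gamma_gt0 : forall i, 0 < gamma i)
    (beta_range : forall i, 0 <= beta i < 1) :
  let x := agghb f gamma beta x0 in
  let f_inf := inf (range f) in
  let A := agghb_A gamma beta in
  let C := agghb_C gamma beta in
  let D := agghb_D gamma beta in
  let E := agghb_E beta in
  - (A / 2) * (1 - C * D * E * L ^+ 2 / m%:R ^+ 2 - L * A) < 0 ->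
  forall K : nat, (1 <= K)%N ->
    min_1_to K (fun k => norm2 (grad f (x k)) ^+ 2)
    <= 2 / K%:R *
       ((f x0 - f_inf) / (A * (1 - C * D * E * L ^+ 2 / m%:R ^+ 2 - L * A))).
Proof.
move=> x f_inf A C D E; set W := 1 - _ - _ => AW K K_gt0.
have AW_gt0 : 0 < A * W by lra.
have rate := rate_le _ _ _ _ _ L_gt0 m_ge1 gamma_gt0 beta_range AW_gt0.
have K_gt0' : 0 < K%:R :> R by rewrite ltr0n.
move: AW_gt0 rate; rewrite -/A -/C -/D -/E -/W.
set c := A * W => c_gt0 rate; set u := fun k => _.
have u_ge0 k : 0 <= u k by rewrite sqr_ge0.
suff : c / 2 * (min_1_to K u *+ K) <= f x0 - f_inf.
  have -> : 2 / K%:R * ((f x0 - f_inf) / c) = (f x0 - f_inf) / (c / 2 * K%:R).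
    by clearbody c; field; rewrite !gt_eqF.
  rewrite ler_pdivlMr; last exact: (mulr_gt0 (divr_gt0 c_gt0 _)).
  by rewrite mulrCA mulr_natr.
(* Taking [K.+1] steps covers the indices 0 to [K]; the term at 0, absent from the minimum, is then
   discarded as nonnegative. *)
have sum_le := sum_sqr_grad_le _ _ _ _ _ _ _ x0 L_gt0 f_smooth
  f_bounded_below m_ge1 gamma_gt0 beta_range K.+1.
apply: le_trans sum_le.
rewrite [X in _ <= X * _]mulrAC big_ltn // -/(u 0).
apply: (@le_trans _ _ (c / 2 * \sum_(1 <= k < K.+1) u k)).
  by rewrite (ler_pM2l (divr_gt0 c_gt0 _)) // min_1_to_mulrn_le_sum.
apply: ler_pM.
- by rewrite divr_ge0 // ltW.
- by apply: sumr_ge0.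
- by rewrite ler_pM2r // invr_gt0.
- by rewrite lerDr.
Qed.
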